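(* Let $n\geq 1$ and let $E:\mathfrak{T}(\mathbb{R})^n\to\mathfrak{T}(\mathbb{R})$ be a function. If $E$ is $OT$-increasing, then the following statements are equivalent: (i) $E$ is idempotent; (ii) $E$ is an $OT$-FTA.
   Context: A triangular fuzzy number (TFN) is identified with a triple $(a,b,c)\in\mathbb{R}^3$ with $a\leq b\leq c$; $\mathfrak{T}(\mathbb{R})$ is the set of all TFNs. $(a_1,b_1,c_1)\leq_{OT}(a_2,b_2,c_2)$ if and only if $b_1<b_2$; or $b_1=b_2$ and $c_1<c_2$; or $b_1=b_2$, $c_1=c_2$ and $a_1\leq a_2$. This is a total order on $\mathfrak{T}(\mathbb{R})$; $\mathrm{Min}_{\leq_{OT}}$ and $\mathrm{Max}_{\leq_{OT}}$ denote the minimum and maximum of a finite set with respect to it. On $\mathfrak{T}(\mathbb{R})^n$, $(A_1,\dots,A_n)\leq_{OT^n}(B_1,\dots,B_n)$ if and only if $A_i\leq_{OT}B_i$ for all $i=1,\dots,n$. A function $E:\mathfrak{T}(\mathbb{R})^n\to\mathfrak{T}(\mathbb{R})$ is $OT$-increasing if $E(\overrightarrow{A})\leq_{OT}E(\overrightarrow{B})$ whenever $\overrightarrow{A}\leq_{OT^n}\overrightarrow{B}$. It is idempotent if $E(A,\dots,A)=A$ for every $A\in\mathfrak{T}(\mathbb{R})$. It is a function of type average ($OT$-FTA) if it is $OT$-increasing and, for all $A_1,\dots,A_n\in\mathfrak{T}(\mathbb{R})$, $\mathrm{Min}_{\leq_{OT}}\{A_1,\dots,A_n\}\leq_{OT}E(A_1,\dots,A_n)\leq_{OT}\mathrm{Max}_{\leq_{OT}}\{A_1,\dots,A_n\}$.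 *)

(* Defs.v *)
From HB Require Import structures.
From mathcomp Require Import all_boot all_order all_algebra.
From mathcomp Require Import reals.

Set Implicit Arguments.
Unset Strict Implicit.
Unset Printing Implicit Defensive.

Import Order.TTheory GRing.Theory Num.Theory.
Local Open Scope ring_scope.

Section TriangularFuzzyNumbers.
Context (R : realType).

(* [TFN ((a, b), c)] is the triangular fuzzy number (a, b, c). *)
Record tfn := TFN {
  tfn_val : R * R * R;
  _ : tfn_val.1.1 <= tfn_val.1.2 <= tfn_val.2 }.

HB.instance Definition _ := [isSub for tfn_val].
HB.instance Definition _ := [Choice of tfn by <:].

Definition tfnA (A : tfn) : R := (val A).1.1.
Definition tfnB (A : tfn) : R := (val A).1.2.
Definition tfnC (A : tfn) : R := (val A).2.

Definition OT_le (A1 A2 : tfn) : bool :=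
  [|| tfnB A1 < tfnB A2,
      (tfnB A1 == tfnB A2) && (tfnC A1 < tfnC A2) |
      [&& tfnB A1 == tfnB A2, tfnC A1 == tfnC A2 & tfnA A1 <= tfnA A2]].

Lemma OT_le_refl : reflexive OT_le.
Proof. by move=> A; rewrite /OT_le !eqxx lexx !orbT. Qed.

Lemma OT_le_anti : antisymmetric OT_le.
Proof.
move=> A1 A2 h; apply: val_inj; move: h; rewrite /OT_le /tfnA /tfnB /tfnC.
case: (val A1) (val A2) => [[a1 b1] c1] [[a2 b2] c2] /=.
case: (ltgtP b1 b2) => //= ->; case: (ltgtP c1 c2) => //= ->.
by move=> /le_anti ->.
Qed.

Lemma OT_le_trans : transitive OT_le.
Proof.
move=> A2 A1 A3; rewrite /OT_le.
case: (ltgtP (tfnB A1) (tfnB A2)) => //= [b12|b12].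
  move=> _; case: (ltgtP (tfnB A2) (tfnB A3)) => //= [b23|b23].
    by rewrite (lt_trans b12 b23).
  by rewrite -b23 b12.
rewrite b12; case: (ltgtP (tfnB A2) (tfnB A3)) => //= _.
case: (ltgtP (tfnC A1) (tfnC A2)) => //= [c12|c12].
  move=> _; case: (ltgtP (tfnC A2) (tfnC A3)) => //= [c23|c23].
    by rewrite (lt_trans c12 c23).
  by rewrite -c23 c12.
by rewrite c12; case: (ltgtP (tfnC A2) (tfnC A3)) => //= _; apply: le_trans.
Qed.

Lemma OT_le_total : total OT_le.
Proof.
move=> A1 A2; rewrite /OT_le.
case: (ltgtP (tfnB A1) (tfnB A2)) => //= _.
by case: (ltgtP (tfnC A1) (tfnC A2)) => //= _; apply: le_total.
Qed.

Fact OT_display : Order.disp_t. Proof. exact: Order.Disp tt tt. Qed.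

HB.instance Definition _ :=
  Order.Le_isPOrder.Build OT_display tfn OT_le_refl OT_le_anti OT_le_trans.
HB.instance Definition _ :=
  Order.POrder_isTotal.Build OT_display tfn OT_le_total.

Fact tfn0_subproof : (0 : R) <= (0 : R) <= (0 : R). Proof. by rewrite lexx. Qed.
Definition tfn0 : tfn := @TFN (0, 0, 0) tfn0_subproof.

(* The finite set {A_1, ..., A_n} is given by a list of its elements; on the
   empty list both functions return the irrelevant default [tfn0]. *)
Definition OT_min (s : seq tfn) : tfn := \big[Order.min/head tfn0 s]_(A <- s) A.
Definition OT_max (s : seq tfn) : tfn := \big[Order.max/head tfn0 s]_(A <- s) A.

Lemma OT_min_mem (s : seq tfn) : s != [::] -> OT_min s \in s.
Proof.
case: s => // A s _; rewrite /OT_min big_seq.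
elim/big_ind: _ => // [|B C hB hC]; first exact: mem_head.
by rewrite minEle; case: ifP.
Qed.

Lemma OT_min_le (s : seq tfn) (A : tfn) : A \in s -> (OT_min s <= A)%O.
Proof.
rewrite /OT_min; move: (head _ _) => x; elim: s => // B s IH.
rewrite inE big_cons ge_min => /predU1P[->|/IH ->]; first by rewrite lexx.
by rewrite orbT.
Qed.

Lemma OT_max_mem (s : seq tfn) : s != [::] -> OT_max s \in s.
Proof.
case: s => // A s _; rewrite /OT_max big_seq.
elim/big_ind: _ => // [|B C hB hC]; first exact: mem_head.
by rewrite maxEle; case: ifP.
Qed.

Lemma OT_max_ge (s : seq tfn) (A : tfn) : A \in s -> (A <= OT_max s)%O.
Proof.
rewrite /OT_max; move: (head _ _) => x; elim: s => // B s IH.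
rewrite inE big_cons le_max => /predU1P[->|/IH ->]; first by rewrite lexx.
by rewrite orbT.
Qed.

Section Functions.
Context (n : nat).

Definition OTn_le (A B : n.-tuple tfn) : Prop :=
  forall i : 'I_n, (tnth A i <= tnth B i)%O.

Definition OT_increasing (E : n.-tuple tfn -> tfn) : Prop :=
  forall A B : n.-tuple tfn, OTn_le A B -> (E A <= E B)%O.

Definition OT_idempotent (E : n.-tuple tfn -> tfn) : Prop :=
  forall A : tfn, E [tuple A | _ < n] = A.

Definition OT_FTA (E : n.-tuple tfn -> tfn) : Prop :=
  OT_increasing E /\
  forall A : n.-tuple tfn, (OT_min A <= E A)%O /\ (E A <= OT_max A)%O.

End Functions.
End TriangularFuzzyNumbers.

(* Main.v *)
Require Import Defs.
From mathcomp Require Import all_boot all_order all_algebra.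
From mathcomp Require Import reals.

Import Order.TTheory.

(** Every tuple lies componentwise between the constant tuples at its minimum and its maximum, so
    monotonicity and idempotence squeeze [E A]. Conversely, a constant tuple has equal minimum and
    maximum, and antisymmetry forces the value of [E]. *)

Theorem proposition5p1 (R : realType) (n : nat) (hn : (1 <= n)%N)
    (E : n.-tuple (tfn R) -> tfn R) (hE : OT_increasing E) :
  OT_idempotent E <-> OT_FTA E.
Proof.
split=> [idE | [_ avgE] A].
  split=> // A; split.
    rewrite -[X in (X <= _)%O]idE; apply: hE => i.
    by rewrite tnth_mktuple OT_min_le ?mem_tnth.
  rewrite -[X in (_ <= X)%O]idE; apply: hE => i.
  by rewrite tnth_mktuple OT_max_ge ?mem_tnth.
set cA := [tuple A | _ < n].
(* [hn] enters here: on an empty tuple [OT_min] and [OT_max] would be the default [tfn0], unrelated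
   to [A]. *)
have cA_neq0 : tval cA != [::] by rewrite -size_eq0 size_tuple -lt0n.
have mem_cA B : B \in cA -> B = A by case/tnthP=> i ->; rewrite tnth_mktuple.
have [] := avgE cA.
rewrite (mem_cA _ (OT_min_mem cA_neq0)) (mem_cA _ (OT_max_mem cA_neq0)).
by move=> leAE leEA; apply/le_anti/andP.
Qed.
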